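(* Let $\gamma(t)$ be a family of strictly convex closed plane curves evolving by $$\frac{\partial}{\partial t}\gamma(t)=\Big(\alpha(t)-\frac1k\Big)N,$$ where $\alpha(t)$ is a $C^\infty$ function depending only on the time $t$. Then the length $L=L(t)$ of $\gamma(t)$ satisfies $$\frac{d}{dt}L=L-2\pi\alpha(t).$$ Moreover, $\frac{d}{dt}L\le 0$ provided $\alpha(t)=\frac1L\int_0^L\frac1k\,ds$.
   Context: The curves are smooth simple closed curves $\gamma(\cdot,t):S^1\to\mathbb{R}^2$ with curvature $k>0$; $N$ is the inward pointing unit normal, $s$ is arc length and $L$ is the length of $\gamma(t)$. *)

(* Defs.v *)
From Stdlib Require Import Reals.
From Coquelicot Require Import Coquelicot.
Open Scope R_scope.

Definition nondegenerate_interval (J : R -> Prop) : Prop :=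
  (forall a b x : R, J a -> J b -> a <= x <= b -> J x) /\
  (exists a b : R, J a /\ J b /\ a < b).

(* Derivative relative to [J]: the usual one at interior points of [J],
   one-sided at an endpoint belonging to [J]. *)
Definition is_derive_on {V : NormedModule R_AbsRing} (J : R -> Prop)
    (f : R -> V) (t : R) (l : V) : Prop :=
  filterlim (fun s : R => scal (/ (s - t)) (minus (f s) (f t)))
    (within (fun s : R => J s /\ s <> t) (locally t)) (locally l).

(* [D n] is the n-th derivative of [f] on [J]. *)
Definition smooth_on {V : NormedModule R_AbsRing} (J : R -> Prop)
    (f : R -> V) : Prop :=
  exists D : nat -> R -> V,
    (forall t : R, J t -> D O t = f t) /\
    (forall (n : nat) (t : R), J t -> is_derive_on J (D n) t (D (S n) t)).

(* [f] is C^oo on [J x R]; [D i j] is the partial derivative of order [i] in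
   the first variable (relative to [J]) and [j] in the second. *)
Definition smooth_family_on {V : NormedModule R_AbsRing} (J : R -> Prop)
    (f : R -> R -> V) : Prop :=
  exists D : nat -> nat -> R -> R -> V,
    (forall t u : R, J t -> D O O t u = f t u) /\
    (forall (i j : nat) (t u : R), J t ->
       is_derive_on J (fun s : R => D i j s u) t (D (S i) j t u) /\
       is_derive (D i j t) u (D i (S j) t u) /\
       filterlim (fun p : R * R => D i j (fst p) (snd p))
         (within (fun p : R * R => J (fst p)) (locally (t, u)))
         (locally (D i j t u))).

Definition dot (p q : R * R) : R := fst p * fst q + snd p * snd q.

(* A map from the circle S^1 = R / 2 pi Z to the plane is represented by a
   2 pi-periodic function R -> R * R. *)
Definition velocity (c : R -> R * R) (u : R) : R * R :=
  (Derive (fun v : R => fst (c v)) u, Derive (fun v : R => snd (c v)) u).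

Definition speed (c : R -> R * R) (u : R) : R :=
  sqrt (dot (velocity c u) (velocity c u)).

Definition tangent (c : R -> R * R) (u : R) : R * R :=
  (fst (velocity c u) / speed c u, snd (velocity c u) / speed c u).

(* Curvature with respect to the unit normal [N]: the component along [N] of
   dT/ds, where T is the unit tangent and d/ds = (1 / speed) d/du. *)
Definition curvature (c N : R -> R * R) (u : R) : R :=
  dot (velocity (tangent c) u) (N u) / speed c u.

(* Integral over the curve with respect to arc length, ds = speed du. *)
Definition arc_integral (c : R -> R * R) (f : R -> R) : R :=
  RInt (fun u : R => f u * speed c u) 0 (2 * PI).

Definition arc_length (c : R -> R * R) : R := arc_integral c (fun _ : R => 1).

(* [p] lies off the curve, and its path component in the complement of the
   curve is bounded. *)
Definition inside (c : R -> R * R) (p : R * R) : Prop :=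
  (forall u : R, c u <> p) /\
  exists M : R, forall q : R -> R * R,
    (forall s : R, continuous q s) ->
    q 0 = p ->
    (forall s u : R, 0 <= s <= 1 -> q s <> c u) ->
    dot (q 1) (q 1) <= M.

Definition inward_unit_normal (c N : R -> R * R) : Prop :=
  forall u : R,
    dot (N u) (N u) = 1 /\
    dot (N u) (velocity c u) = 0 /\
    exists e0 : R, 0 < e0 /\
      forall e : R, 0 < e < e0 ->
        inside c (fst (c u) + e * fst (N u), snd (c u) + e * snd (N u)).

(* Injectivity on S^1 is injectivity modulo the period. *)
Definition regular_simple_closed (c : R -> R * R) : Prop :=
  (forall u : R, c (u + 2 * PI) = c u) /\
  (forall u : R, velocity c u <> (0, 0)) /\
  (forall u v : R, c u = c v -> exists z : Z, u = v + 2 * PI * IZR z).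

(* Main.v *)
(* Since [gamma_t . T = 0] along the curve, differentiating in [u] shows that the
   length element [v = |gamma_u|] evolves by
   [v_t = (gamma_t)_u . T = - gamma_t . T_u = v - alpha k v]; integrating,
   [L' = L - alpha * (int k ds)], and [int k ds = 2 pi].  The second claim is the
   Cauchy-Schwarz inequality [L^2 <= (int k ds) (int 1/k ds)].

   That the total curvature [W] is [2 pi] uses convexity rather than Hopf's
   homotopy.  Parametrize the curve by its tangent angle and let [h] be its
   support function, of period [W].  The function [p |-> int_p^(p + 2 pi) h] attains a
   minimum at some [z].  There the first derivative shows that the tangent
   lines at [z] and [z + 2 pi] coincide, and the second derivative that the
   latter contact point is the same as the former or lies ahead of it.  In the
   second case the loop over [z, z + 2 pi] crosses itself.  Hence there is a
   double point at angular distance at most [2 pi], so [W <= 2 pi] for a simple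
   curve, whereas [W] is a positive multiple of [2 pi]. *)

Require Import Defs.
From Stdlib Require Import Reals Ranalysis5 Lra Lia ClassicalEpsilon.
From Coquelicot Require Import Coquelicot.
Open Scope R_scope.

(** * One-variable calculus *)

Lemma is_derive_continuity_pt (f : R -> R) (x l : R) :
  is_derive f x l -> continuity_pt f x.
Proof.
  intros H. apply continuity_pt_filterlim.
  apply (ex_derive_continuous (V := R_NormedModule)). now exists l.
Qed.

(** The inverse is picked by choice. An increasing [f] reflects strict order, so preimages of values
    near [y] are squeezed between [g y - eps] and [g y + eps], which gives continuity. *)
Lemma increasing_inverse (f : R -> R) :
  (forall x y, x < y -> f x < f y) -> (forall y, exists x, f x = y) ->
  exists g : R -> R, (forall y, f (g y) = y) /\ (forall x, g (f x) = x) /\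
    continuity g.
Proof.
  intros Hinc Hsurj.
  set (g := fun y => proj1_sig (constructive_indefinite_description _ (Hsurj y))).
  assert (fg : forall y, f (g y) = y).
  { intros y. unfold g. now destruct (constructive_indefinite_description _ _). }
  assert (refl : forall x y, f x < f y -> x < y).
  { intros x y H. destruct (Rlt_le_dec x y) as [|[H'| ->]]; auto.
    - specialize (Hinc _ _ H'). lra.
    - lra. }
  exists g. split; [exact fg|split].
  - intros x. specialize (fg (f x)).
    destruct (Rtotal_order (g (f x)) x) as [H|[H|H]]; auto;
      specialize (Hinc _ _ H); lra.
  - intros y. apply continuity_pt_locally. intros eps. pose proof (cond_pos eps).
    assert (H1 : f (g y - eps) < y) by (rewrite <- (fg y) at 2; apply Hinc; lra).
    assert (H2 : y < f (g y + eps)) by (rewrite <- (fg y) at 1; apply Hinc; lra).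
    assert (Hd : 0 < Rmin (y - f (g y - eps)) (f (g y + eps) - y))
      by (apply Rmin_glb_lt; lra).
    exists (mkposreal _ Hd). intros z Hz.
    unfold ball in Hz; simpl in Hz; unfold AbsRing_ball, abs, minus, plus, opp in Hz; simpl in Hz.
    pose proof (Rmin_l (y - f (g y - eps)) (f (g y + eps) - y)).
    pose proof (Rmin_r (y - f (g y - eps)) (f (g y + eps) - y)).
    apply Rabs_lt_between in Hz.
    assert (g y - eps < g z) by (apply refl; rewrite fg; lra).
    assert (g z < g y + eps) by (apply refl; rewrite fg; lra).
    apply Rabs_lt_between. lra.
Qed.

(** Clamping the argument to [[a, b]] and adding the clamped-off excess continues [f] with slope one
    on both sides. The result is an increasing bijection of the line, whose inverse restricts to the
    one wanted. *)
Lemma increasing_inverse_interval (f : R -> R) (a b : R) :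
  a < b -> (forall x, a <= x <= b -> continuity_pt f x) ->
  (forall x y, a <= x -> x < y -> y <= b -> f x < f y) ->
  exists g : R -> R, continuity g /\
    forall y, f a <= y <= f b -> a <= g y <= b /\ f (g y) = y.
Proof.
  intros Hab Hc Hinc.
  set (cl := fun x => Rmax a (Rmin x b)).
  assert (Hcl : forall x, (x < a /\ cl x = a) \/ (a <= x <= b /\ cl x = x) \/ (b < x /\ cl x = b)).
  { intros x. unfold cl. destruct (Rlt_le_dec x a).
    - left. rewrite Rmin_left, Rmax_left by lra. auto.
    - destruct (Rle_lt_dec x b).
      + right; left. rewrite Rmin_left, Rmax_right by lra. auto.
      + right; right. rewrite Rmin_right, Rmax_right by lra. auto. }
  assert (Hmono : forall x y, a <= x -> x <= y -> y <= b -> f x <= f y).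
  { intros x y Hx [H| ->] Hy; [left; apply Hinc; auto|lra]. }
  destruct (increasing_inverse (fun x => f (cl x) + (x - cl x))) as (g & fg & gf & Hg).
  - intros x y Hxy.
    destruct (Hcl x) as [[? ->]|[[? ->]|[? ->]]], (Hcl y) as [[? ->]|[[? ->]|[? ->]]]; try lra.
    + pose proof (Hmono a y ltac:(lra) ltac:(lra) ltac:(lra)). lra.
    + pose proof (Hmono a b ltac:(lra) ltac:(lra) ltac:(lra)). lra.
    + pose proof (Hinc x y ltac:(lra) ltac:(lra) ltac:(lra)). lra.
    + pose proof (Hmono x b ltac:(lra) ltac:(lra) ltac:(lra)). lra.
  - intros y. destruct (Rlt_le_dec y (f a)).
    + exists (a - (f a - y)). destruct (Hcl (a - (f a - y))) as [[? ->]|[[? ->]|[? ->]]]; lra.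
    + destruct (Rlt_le_dec (f b) y).
      * exists (b + (y - f b)). destruct (Hcl (b + (y - f b))) as [[? ->]|[[? ->]|[? ->]]]; lra.
      * destruct (f_interv_is_interv f a b y Hab) as (x & Hx & <-); auto.
        exists x. destruct (Hcl x) as [[? ->]|[[? ->]|[? ->]]]; lra.
  - exists g. split; auto. intros y Hy.
    pose proof (fg y) as E. cbv beta in E.
    destruct (Hcl (g y)) as [[? H]|[[? H]|[? H]]]; rewrite H in E; try lra.
Qed.

Lemma is_derive_inverse (f df g : R -> R) :
  (forall x, is_derive f x (df x)) -> (forall x, 0 < df x) ->
  (forall y, f (g y) = y) -> continuity g ->
  forall y, is_derive g y (/ df (g y)).
Proof.
  intros Hf Hdf fg Hg y.
  (* The inverse function rule is stated on an interval; the one from [g (y - 1)] to [g (y + 1)]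
     surrounds [g y]. *)
  assert (Prf : forall a, g (y - 1) <= a <= g (y + 1) -> derivable_pt f a).
  { intros a _. exists (df a). apply is_derive_Reals, Hf. }
  assert (refl : forall u v, u < v -> g u <= g v).
  { intros u v H. destruct (Rle_lt_dec (g u) (g v)); auto.
    pose proof (incr_function f m_infty p_infty df (fun x _ _ => Hf x)
      (fun x _ _ => Hdf x) (g v) (g u) I r I). rewrite !fg in H0. lra. }
  assert (Hin : g (y - 1) <= g y <= g (y + 1)) by (split; apply refl; lra).
  assert (E : derive_pt f (g y) (Prf (g y) Hin) = df (g y)).
  { apply derive_pt_eq. apply is_derive_Reals, Hf. }
  apply is_derive_Reals. replace (/ df (g y)) with (1 / derive_pt f (g y) (Prf (g y) Hin)).
  - apply derivable_pt_lim_recip_interv; auto; try lra.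
    + intros x _. apply fg.
    + rewrite E. specialize (Hdf (g y)). lra.
  - rewrite E. unfold Rdiv. ring.
Qed.

Lemma is_derive_pos_incr (f df : R -> R) (a b : R) :
  (forall x, a <= x <= b -> is_derive f x (df x)) ->
  (forall x, a < x < b -> 0 < df x) ->
  forall x y, a <= x -> x < y -> y <= b -> f x < f y.
Proof.
  intros Hf Hdf x y Hx Hxy Hy.
  destruct (MVT_cor2 f df x y Hxy) as (c & E & Hc).
  - intros c Hc. apply is_derive_Reals, Hf. lra.
  - pose proof (Hdf c ltac:(lra)). nra.
Qed.

(** * Total curvature of a simple locally convex curve *)

(* The arc over [0, pi] and the arc over [pi, 2 pi] have a common top; compare
   their abscissae at equal height: the first one starts to the left of the
   second one, and near the top it lies to its right. *)
Lemma loop_crossing (X Y r : R -> R) :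
  (forall p, is_derive X p (r p * cos p)) ->
  (forall p, is_derive Y p (r p * sin p)) ->
  (forall p, 0 < r p) ->
  Y 0 = Y (2 * PI) -> X 0 < X (2 * PI) ->
  exists p q, 0 <= p < q /\ q <= 2 * PI /\ X p = X q /\ Y p = Y q.
Proof.
  intros HX HY Hr EY LX. pose proof PI_RGT_0 as Hpi.
  assert (cX : continuity X) by (intros p; eapply is_derive_continuity_pt, HX).
  assert (cY : continuity Y) by (intros p; eapply is_derive_continuity_pt, HY).
  assert (Yup : forall x y, 0 <= x -> x < y -> y <= PI -> Y x < Y y).
  { apply is_derive_pos_incr with (df := fun p => r p * sin p); auto.
    intros x Hx. apply Rmult_lt_0_compat; auto. apply sin_gt_0; lra. }
  assert (Ydown : forall x y, PI <= x -> x < y -> y <= 2 * PI -> - Y x < - Y y).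
  { apply is_derive_pos_incr with (f := fun p => - Y p) (df := fun p => - (r p * sin p)).
    - intros x _. apply (is_derive_opp (V := R_NormedModule)), HY.
    - intros x Hx. assert (sin x < 0) by (apply sin_lt_0; lra).
      specialize (Hr x). nra. }
  assert (Xdown : forall x y, PI / 2 <= x -> x < y -> y <= 3 * (PI / 2) -> - X x < - X y).
  { apply is_derive_pos_incr with (f := fun p => - X p) (df := fun p => - (r p * cos p)).
    - intros x _. apply (is_derive_opp (V := R_NormedModule)), HX.
    - intros x Hx. assert (cos x < 0) by (apply cos_lt_0; lra).
      specialize (Hr x). nra. }
  (* [g (- Y p)] will be the parameter on the descending arc at the height of the ascending point
     [p]; the sign makes the inverted function increasing. *)
  destruct (increasing_inverse_interval (fun p => - Y p) PI (2 * PI)) as (g & cg & Hg); auto.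
  { lra. }
  { intros x _. apply continuity_pt_opp, cY. }
  assert (Hrange : forall p, 0 <= p <= PI -> - Y PI <= - Y p <= - Y (2 * PI)).
  { intros p Hp. rewrite <- EY. split.
    - destruct (Req_dec p PI) as [->|]; [lra|]. pose proof (Yup p PI). lra.
    - destruct (Req_dec p 0) as [->|]; [lra|]. pose proof (Yup 0 p). lra. }
  assert (Hg' : forall p, 0 <= p <= PI -> PI <= g (- Y p) <= 2 * PI /\ Y (g (- Y p)) = Y p).
  { intros p Hp. destruct (Hg _ (Hrange p Hp)) as [H1 H2]. split; auto. lra. }
  (* Take the height of the higher of the points at [PI / 2] and [3 * (PI / 2)]. At that height both
     arcs are met inside [[PI / 2, 3 * (PI / 2)]], where [X] decreases. *)
  assert (Hstar : exists ps, 0 < ps < PI /\ X (g (- Y ps)) < X ps).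
  { destruct (Rle_lt_dec (Y (3 * (PI / 2))) (Y (PI / 2))) as [H|H].
    - exists (PI / 2). split; [lra|].
      destruct (Hg' (PI / 2)) as [H1 H2]; [lra|]. set (q := g _) in *.
      assert (q <= 3 * (PI / 2)).
      { destruct (Rle_lt_dec q (3 * (PI / 2))); auto.
        pose proof (Ydown (3 * (PI / 2)) q). lra. }
      pose proof (Xdown (PI / 2) q). lra.
    - destruct (f_interv_is_interv Y (PI / 2) PI (Y (3 * (PI / 2)))) as (ps & Hps & E).
      + lra.
      + pose proof (Ydown PI (3 * (PI / 2))). lra.
      + intros; apply cY.
      + assert (ps < PI).
        { destruct (Req_dec ps PI) as [->|]; [|lra].
          pose proof (Ydown PI (3 * (PI / 2))). lra. }
        exists ps. split; [lra|]. destruct (Hg' ps) as [H1 H2]; [lra|]. set (q := g _) in *.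
        assert (q = 3 * (PI / 2)) as ->.
        { destruct (Rtotal_order q (3 * (PI / 2))) as [L|[L|L]]; auto.
          - pose proof (Ydown q (3 * (PI / 2))). lra.
          - pose proof (Ydown (3 * (PI / 2)) q). lra. }
        pose proof (Xdown ps (3 * (PI / 2))). lra. }
  destruct Hstar as (ps & Hps & Hlt).
  (* At [p = 0] the partner of equal height is [2 * PI] and lies to the right; at [ps] it lies to
     the left. A zero of the difference is a crossing, and [p < PI <= g (- Y p)] keeps the
     parameters distinct. *)
  destruct (IVT_interv (fun p => X p - X (g (- Y p))) 0 ps) as (p & Hp & E).
  - intros a _. apply continuity_pt_minus; [apply cX|].
    apply (continuity_pt_comp (fun p => g (- Y p)) X); [|apply cX].
    apply (continuity_pt_comp (fun p => - Y p) g); [|apply cg].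
    apply continuity_pt_opp, cY.
  - lra.
  - cbv beta. destruct (Hg' 0) as [H1 H2]; [lra|]. set (q := g (- Y 0)) in *.
    assert (q = 2 * PI) as ->; [|lra].
    destruct (Req_dec q (2 * PI)); auto. pose proof (Ydown q (2 * PI)). lra.
  - lra.
  - destruct (Hg' p) as [H1 H2]; [lra|]. exists p, (g (- Y p)). lra.
Qed.

(** A minimum over [[0, P]] is global by periodicity. The two-sided window makes it interior even if
    [z] is an endpoint of [[0, P]]. *)
Lemma periodic_min (Q : R -> R) (P : R) :
  0 < P -> continuity Q -> (forall x, Q (x + P) = Q x) ->
  exists z, forall x, z - P <= x <= z + P -> Q z <= Q x.
Proof.
  intros HP cQ HQ.
  destruct (continuity_ab_min Q 0 P) as (z & Hz & Hin); [lra|intros; apply cQ|].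
  exists z. intros x Hx. destruct (Rlt_le_dec x 0).
  - rewrite <- (HQ x). apply Hz. lra.
  - destruct (Rle_lt_dec x P); [apply Hz; lra|].
    replace x with (x - P + P) by ring. rewrite HQ. apply Hz. lra.
Qed.

(* If [l < 0], then [q < 0] just to the right of [z], where [Q] would decrease. *)
Lemma second_derivative_at_min (Q q : R -> R) (z d l : R) :
  0 < d -> (forall x, is_derive Q x (q x)) -> is_derive q z l ->
  (forall x, z - d <= x <= z + d -> Q z <= Q x) -> q z = 0 /\ 0 <= l.
Proof.
  intros Hd HQ Hq Hmin.
  assert (Hz : q z = 0).
  { assert (pr : derivable_pt Q z) by (exists (q z); apply is_derive_Reals, HQ).
    rewrite <- (proj2 (derive_pt_eq Q z (q z) pr) (proj1 (is_derive_Reals _ _ _) (HQ z))).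
    apply (deriv_minimum Q (z - d) (z + d)); try lra.
    intros x H1 H2. apply Hmin. lra. }
  split; auto. destruct (Rle_lt_dec 0 l) as [|Hl]; auto. exfalso.
  apply is_derive_Reals in Hq. destruct (Hq (- l)) as [e He]; [lra|].
  pose proof (cond_pos e) as He0.
  set (h := Rmin d e / 2).
  pose proof (Rmin_glb_lt d e 0 Hd He0). pose proof (Rmin_l d e). pose proof (Rmin_r d e).
  assert (0 < h /\ h < d /\ h < e) as (h0 & hd & he) by (unfold h; lra).
  destruct (MVT_cor2 Q q z (z + h)) as (c & E & Hc); [lra|intros; apply is_derive_Reals, HQ|].
  specialize (He (c - z) ltac:(lra) ltac:(rewrite Rabs_pos_eq; lra)).
  replace (z + (c - z)) with c in He by ring. rewrite Hz, Rminus_0_r in He.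
  apply Rabs_lt_between in He.
  assert (q c / (c - z) < 0) by lra.
  assert (q c < 0).
  { replace (q c) with (q c / (c - z) * (c - z)) by (field; lra). nra. }
  specialize (Hmin (z + h) ltac:(lra)). nra.
Qed.

Lemma is_derive_Rmult (f g : R -> R) (x df dg : R) :
  is_derive f x df -> is_derive g x dg ->
  is_derive (fun t => f t * g t) x (df * g x + f x * dg).
Proof.
  intros Hf Hg. apply is_derive_Reals.
  now apply (derivable_pt_lim_mult f g); apply is_derive_Reals.
Qed.

Lemma is_derive_linear_combination (f g : R -> R) (a b x df dg : R) :
  is_derive f x df -> is_derive g x dg ->
  is_derive (fun t => f t * a + g t * b) x (df * a + dg * b).
Proof.
  intros Hf Hg.
  apply (is_derive_ext (fun t => plus (scal a (f t)) (scal b (g t)))).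
  - intros t. unfold plus, scal; simpl. unfold mult; simpl. ring.
  - evar_last.
    + apply (is_derive_plus (V := R_NormedModule));
        apply is_derive_scal; [exact Hf | exact Hg].
    + unfold plus, scal; simpl. unfold mult; simpl. ring.
Qed.

Lemma is_derive_translate (f : R -> R) (a x l : R) :
  is_derive f (a + x) l -> is_derive (fun t => f (a + t)) x l.
Proof.
  intros H. evar_last; [apply (is_derive_comp f (fun t => a + t)); [exact H|]|].
  - auto_derive; auto.
  - apply Rmult_1_l.
Qed.

Lemma rotation_eq0 (z x y : R) :
  x * cos z + y * sin z = 0 -> y * cos z - x * sin z = 0 -> x = 0 /\ y = 0.
Proof.
  intros H1 H2. pose proof (sin2_cos2 z) as S. unfold Rsqr in S. split.
  - transitivity ((x * cos z + y * sin z) * cos z - (y * cos z - x * sin z) * sin z).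
    + transitivity (x * (sin z * sin z + cos z * cos z)); [rewrite S; ring|ring].
    + rewrite H1, H2. ring.
  - transitivity ((x * cos z + y * sin z) * sin z + (y * cos z - x * sin z) * cos z).
    + transitivity (y * (sin z * sin z + cos z * cos z)); [rewrite S; ring|ring].
    + rewrite H1, H2. ring.
Qed.

Lemma continuity_ex_RInt (f : R -> R) (a b : R) : continuity f -> ex_RInt f a b.
Proof.
  intros H. apply (ex_RInt_continuous (V := R_CompleteNormedModule)).
  intros z _. apply continuity_pt_filterlim, H.
Qed.

Lemma is_derive_RInt_continuity (f : R -> R) (a x : R) :
  continuity f -> is_derive (fun x => RInt f a x) x (f x).
Proof.
  intros H. apply (is_derive_RInt (V := R_NormedModule) f _ a).
  - apply filter_forall. intros y. apply (RInt_correct (V := R_CompleteNormedModule)).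
    now apply continuity_ex_RInt.
  - apply continuity_pt_filterlim, H.
Qed.

Lemma RInt_shift (f : R -> R) (P a b : R) :
  continuity f -> RInt (fun x => f (x + P)) a b = RInt f (a + P) (b + P).
Proof.
  intros H. pose proof (RInt_comp_lin (V := R_CompleteNormedModule) f 1 P a b) as E.
  rewrite !Rmult_1_l in E. rewrite <- E by now apply continuity_ex_RInt.
  apply RInt_ext. intros x _. simpl. unfold scal; simpl; unfold mult; simpl.
  now rewrite !Rmult_1_l.
Qed.

(* [h] is the support function in terms of the normal angle.  At a minimum of
   its moving average over a full turn, the tangent lines at angles [z] and
   [z + 2 pi] coincide and the second contact point lies ahead of the first. *)
Lemma closed_curve_by_angle_double_point (X Y r : R -> R) (P : R) :
  (forall p, is_derive X p (r p * cos p)) ->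
  (forall p, is_derive Y p (r p * sin p)) ->
  (forall p, 0 < r p) -> 0 < P ->
  (forall p, X (p + P) = X p) -> (forall p, Y (p + P) = Y p) ->
  (forall p, cos (p + P) = cos p) -> (forall p, sin (p + P) = sin p) ->
  exists p q, p < q <= p + 2 * PI /\ X p = X q /\ Y p = Y q.
Proof.
  intros HX HY Hr HP pX pY pcos psin. pose proof PI_RGT_0 as Hpi.
  set (h := fun p => X p * sin p - Y p * cos p).
  (* The [r] terms cancel, so the derivative of the support function is the tangential component of
     the position. *)
  assert (Hh : forall p, is_derive h p (X p * cos p + Y p * sin p)).
  { intros p. unfold h.
    evar_last; [apply (is_derive_minus (V := R_NormedModule)); apply is_derive_Rmult;
      [apply HX|apply is_derive_Reals, derivable_pt_lim_sin
      |apply HY|apply is_derive_Reals, derivable_pt_lim_cos]|].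
    unfold minus, plus, opp; simpl. ring. }
  assert (ch : continuity h) by (intros p; eapply is_derive_continuity_pt, Hh).
  set (q := fun p => h (p + 2 * PI) - h p).
  set (Q := fun p => RInt h p (p + 2 * PI)).
  assert (HQ : forall p, is_derive Q p (q p)).
  { intros p.
    apply (is_derive_ext (fun p => RInt h 0 (p + 2 * PI) - RInt h 0 p)).
    - intros t. unfold Q.
      rewrite <- (RInt_Chasles h 0 t (t + 2 * PI)) by now apply continuity_ex_RInt.
      unfold plus; simpl. lra.
    - apply (is_derive_minus (V := R_NormedModule)); [|now apply is_derive_RInt_continuity].
      evar_last; [apply (is_derive_comp (fun x => RInt h 0 x) (fun p => p + 2 * PI) p)|].
      + now apply is_derive_RInt_continuity.
      + auto_derive; auto.
      + apply Rmult_1_l. }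
  (* [q p] is the component of the chord from [p] to [p + 2 * PI] along the normal
     [(sin p, - cos p)]; its derivative is the component along the tangent direction. *)
  assert (Hq : forall p, is_derive q p
    ((X (p + 2 * PI) - X p) * cos p + (Y (p + 2 * PI) - Y p) * sin p)).
  { intros p. evar_last; [apply (is_derive_minus (V := R_NormedModule)); [|apply Hh]|].
    - apply (is_derive_comp h (fun p => p + 2 * PI) p); [apply Hh|].
      auto_derive; auto.
    - unfold minus, plus, opp, scal, mult; simpl.
      unfold mult; simpl. rewrite sin_plus, cos_plus, sin_2PI, cos_2PI. ring. }
  destruct (periodic_min Q P) as (z & Hz); auto.
  { intros p. eapply is_derive_continuity_pt, HQ. }
  { intros p. unfold Q. replace (p + P + 2 * PI) with (p + 2 * PI + P) by ring.
    rewrite <- RInt_shift by auto. apply RInt_ext. intros t _. unfold h.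
    now rewrite pX, pY, pcos, psin. }
  (* At the minimum the chord has zero normal and nonnegative tangential component. If the latter is
     positive, rotation by [- z] makes the tangent at [z] horizontal and [loop_crossing] applies; if
     it is zero, the two points coincide. *)
  destruct (second_derivative_at_min Q q z P _ HP HQ (Hq z) Hz) as (E & [Hlt|Heq]).
  - destruct (loop_crossing
      (fun p => X (z + p) * cos z + Y (z + p) * sin z)
      (fun p => Y (z + p) * cos z + X (z + p) * - sin z)
      (fun p => r (z + p))) as (u & v & Huv & Hv & E1 & E2).
    + intros p. evar_last;
        [apply (is_derive_linear_combination (fun p => X (z + p)) (fun p => Y (z + p)));
         apply is_derive_translate; [apply HX|apply HY]|].
      replace (cos p) with (cos ((z + p) - z)) by (f_equal; ring).
      rewrite cos_minus. ring.
    + intros p. evar_last;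
        [apply (is_derive_linear_combination (fun p => Y (z + p)) (fun p => X (z + p)));
         apply is_derive_translate; [apply HY|apply HX]|].
      replace (sin p) with (sin ((z + p) - z)) by (f_equal; ring).
      rewrite sin_minus. ring.
    + auto.
    + unfold q, h in E. rewrite sin_plus, cos_plus, sin_2PI, cos_2PI in E. rewrite Rplus_0_r. lra.
    + rewrite Rplus_0_r. lra.
    + exists (z + u), (z + v).
      destruct (rotation_eq0 z (X (z + u) - X (z + v)) (Y (z + u) - Y (z + v))); lra.
  - exists z, (z + 2 * PI).
    unfold q, h in E. rewrite sin_plus, cos_plus, sin_2PI, cos_2PI in E.
    destruct (rotation_eq0 z (X (z + 2 * PI) - X z) (Y (z + 2 * PI) - Y z)); lra.
Qed.

(** * From a double point to the total curvature *)

Lemma quasi_periodic_IZR (f : R -> R) (P W : R) :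
  (forall x, f (x + P) = f x + W) ->
  forall (z : Z) x, f (x + P * IZR z) = f x + W * IZR z.
Proof.
  intros H z. induction z using Z.peano_ind; intros x.
  - rewrite !Rmult_0_r, !Rplus_0_r. auto.
  - rewrite succ_IZR. replace (x + P * (IZR z + 1)) with (x + P * IZR z + P) by ring.
    rewrite H, IHz. ring.
  - replace (IZR (Z.pred z)) with (IZR z - 1) by (rewrite <- minus_IZR; reflexivity).
    specialize (H (x + P * (IZR z - 1))).
    replace (x + P * (IZR z - 1) + P) with (x + P * IZR z) in H by ring.
    rewrite IHz in H. lra.
Qed.

(** [acos a] has the right cosine, and its sine agrees with [b] up to sign; a wrong sign is
    corrected by negating the angle. *)
Lemma unit_vector_angle (a b : R) :
  a * a + b * b = 1 -> exists p, a = cos p /\ b = sin p.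
Proof.
  intros H. assert (-1 <= a <= 1) by nra.
  assert (S : sin (acos a) * sin (acos a) = b * b).
  { pose proof (sin2_cos2 (acos a)) as S. unfold Rsqr in S. rewrite cos_acos in S by auto. lra. }
  destruct (Rsqr_eq b (sin (acos a))) as [E|E]; [unfold Rsqr; lra| |].
  - exists (acos a). now rewrite cos_acos.
  - exists (- acos a). rewrite cos_neg, sin_neg, cos_acos; auto.
Qed.

(* In terms of the tangent angle the curve becomes [X' = r cos, Y' = r sin] with
   period [W], the total curvature, which is a multiple of [2 pi]; a double
   point at angular distance at most [2 pi] forces [W <= 2 pi]. *)
Lemma total_curvature_simple_locally_convex (x y a b v w : R -> R) (P : R) :
  0 < P ->
  (forall u, is_derive x u (v u * a u)) -> (forall u, is_derive y u (v u * b u)) ->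
  (forall u, 0 < v u) -> (forall u, a u * a u + b u * b u = 1) ->
  (forall u, is_derive a u (- w u * b u)) -> (forall u, is_derive b u (w u * a u)) ->
  continuity w -> (forall u, 0 < w u) ->
  (forall u, x (u + P) = x u) -> (forall u, y (u + P) = y u) ->
  (forall u, a (u + P) = a u) -> (forall u, b (u + P) = b u) ->
  (forall u, w (u + P) = w u) ->
  (forall s t, x s = x t -> y s = y t -> exists z : Z, s = t + P * IZR z) ->
  RInt w 0 P = 2 * PI.
Proof.
  intros HP Hx Hy Hv Hab Ha Hb cw Hw px py pa pb pw Hinj.
  pose proof PI_RGT_0 as Hpi.
  destruct (unit_vector_angle (a 0) (b 0) (Hab 0)) as (t0 & Ea0 & Eb0).
  (* The tangent angle, as the integral of the turning rate [w] from an angle of the initial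
     tangent. *)
  set (theta := fun u => t0 + RInt w 0 u).
  assert (Ht : forall u, is_derive theta u (w u)).
  { intros u. evar_last; [apply (is_derive_plus (V := R_NormedModule));
      [apply is_derive_const|now apply is_derive_RInt_continuity]|].
    apply plus_zero_l. }
  assert (Hcos : forall u, is_derive (fun s => cos (theta s)) u (- w u * sin (theta u))).
  { intros u. evar_last; [apply (is_derive_comp cos theta);
      [apply is_derive_Reals, derivable_pt_lim_cos|apply Ht]|].
    unfold scal; simpl; unfold mult; simpl. ring. }
  assert (Hsin : forall u, is_derive (fun s => sin (theta s)) u (w u * cos (theta u))).
  { intros u. evar_last; [apply (is_derive_comp sin theta);
      [apply is_derive_Reals, derivable_pt_lim_sin|apply Ht]|].
    unfold scal; simpl; unfold mult; simpl. ring. }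
  assert (theta0 : theta 0 = t0).
  { unfold theta. rewrite RInt_point. apply Rplus_0_r. }
  assert (Hangle : forall u, a u = cos (theta u) /\ b u = sin (theta u)).
  { intros u.
    (* The inner product of [(a, b)] with [(cos theta, sin theta)] is constant and equals 1 at [0];
       unit vectors with inner product 1 coincide. *)
    assert (D : forall s, is_derive (fun s => a s * cos (theta s) + b s * sin (theta s)) s 0).
    { intros s. evar_last; [apply (is_derive_plus (V := R_NormedModule));
        apply is_derive_Rmult; [apply Ha|apply Hcos|apply Hb|apply Hsin]|].
      unfold plus; simpl. ring. }
    assert (E : a u * cos (theta u) + b u * sin (theta u) = 1).
    { transitivity (a 0 * cos (theta 0) + b 0 * sin (theta 0)).
      - destruct (MVT_gen (fun s => a s * cos (theta s) + b s * sin (theta s)) 0 u (fun _ => 0))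
          as (c & _ & Ec).
        + intros s _. apply D.
        + intros s _. eapply is_derive_continuity_pt, D.
        + cbv beta in Ec. lra.
      - rewrite theta0, <- Ea0, <- Eb0. apply Hab. }
    pose proof (Hab u). pose proof (sin2_cos2 (theta u)) as S. unfold Rsqr in S.
    assert ((a u - cos (theta u)) * (a u - cos (theta u)) +
            (b u - sin (theta u)) * (b u - sin (theta u)) = 0) as S2 by lra.
    apply (Rplus_sqr_eq_0 (a u - cos (theta u)) (b u - sin (theta u))) in S2. lra. }
  set (W := RInt w 0 P).
  assert (HW : 0 < W).
  { apply RInt_gt_0; auto. intros. apply continuity_pt_filterlim, cw. }
  assert (thetaP : forall u, theta (u + P) = theta u + W).
  { intros u. unfold theta, W.
    rewrite <- (RInt_Chasles w 0 P (u + P)) by now apply continuity_ex_RInt.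
    replace (RInt w P (u + P)) with (RInt w (0 + P) (u + P)) by now rewrite Rplus_0_l.
    rewrite <- RInt_shift by auto.
    rewrite (RInt_ext (fun s => w (s + P)) w) by (intros; apply pw).
    unfold plus; simpl. ring. }
  pose proof (quasi_periodic_IZR theta P W thetaP) as thetaZ.
  (* [W] is the increment of the tangent angle between the equal tangent vectors at [0] and [P]. *)
  assert (cosW : cos W = 1 /\ sin W = 0).
  { destruct (Hangle 0) as [E1 E2]. destruct (Hangle (0 + P)) as [E3 E4].
    rewrite thetaP in E3, E4. rewrite pa in E3. rewrite pb in E4.
    replace W with (theta 0 + W - theta 0) by ring.
    rewrite cos_minus, sin_minus, <- E3, <- E4, <- E1, <- E2. split; [|ring].
    apply Hab. }
  destruct cosW as [cosW sinW].
  destruct (increasing_inverse theta) as (tau & theta_tau & tau_theta & ctau).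
  - intros s t Hst. apply (incr_function theta m_infty p_infty w (fun u _ _ => Ht u) (fun u _ _ => Hw u));
      simpl; auto.
  (* [theta] gains [W > 0] in each period, so [n] periods on either side of [0] bracket the value
     [t]. *)
  - intros t. set (n := up (Rabs (t - theta 0) / W)).
    assert (Hn : Rabs (t - theta 0) < W * IZR n).
    { destruct (archimed (Rabs (t - theta 0) / W)) as [H _]. fold n in H.
      apply (Rmult_lt_compat_l W) in H; auto.
      replace (W * (Rabs (t - theta 0) / W)) with (Rabs (t - theta 0)) in H by (field; lra).
      auto. }
    apply Rabs_lt_between in Hn.
    destruct (IVT_gen theta (0 + P * IZR (- n)) (0 + P * IZR n) t) as (s & _ & Hs).
    + intros s. eapply is_derive_continuity_pt, Ht.
    + rewrite !thetaZ, opp_IZR. rewrite Rmin_left, Rmax_right by lra. lra.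
    + now exists s.
  - assert (Htau : forall p, is_derive tau p (/ w (tau p)))
      by now apply (is_derive_inverse theta).
    assert (tauW : forall p, tau (p + W) = tau p + P).
    { intros p. rewrite <- (tau_theta (tau p + P)). now rewrite thetaP, theta_tau. }
    (* With the tangent angle as parameter the speed is [v / w], the radius of curvature. *)
    destruct (closed_curve_by_angle_double_point (fun p => x (tau p)) (fun p => y (tau p))
      (fun p => v (tau p) / w (tau p)) W) as (p & q & Hpq & E1 & E2).
    + intros p. evar_last; [apply (is_derive_comp x tau); [apply Hx|apply Htau]|].
      destruct (Hangle (tau p)) as [-> _]. rewrite theta_tau.
      unfold scal; simpl; unfold mult; simpl. unfold Rdiv. ring.
    + intros p. evar_last; [apply (is_derive_comp y tau); [apply Hy|apply Htau]|].
      destruct (Hangle (tau p)) as [_ ->]. rewrite theta_tau.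
      unfold scal; simpl; unfold mult; simpl. unfold Rdiv. ring.
    + intros p. now apply Rdiv_lt_0_compat.
    + exact HW.
    + intros p. now rewrite tauW.
    + intros p. now rewrite tauW.
    + intros p. rewrite cos_plus, cosW, sinW. ring.
    + intros p. rewrite sin_plus, cosW, sinW. ring.
    + destruct (Hinj (tau q) (tau p)) as (z & Hz); auto.
      (* Simplicity makes the double point a shift by [z] whole periods; [p < q] forces [z >= 1],
         whence [W <= q - p <= 2 * PI]. *)
      assert (Eq : q = p + W * IZR z).
      { rewrite <- (theta_tau q), <- (theta_tau p) at 1. rewrite <- thetaZ. now f_equal. }
      assert (1 <= IZR z).
      { apply IZR_le. assert (0 < z)%Z; [|lia]. apply lt_IZR. nra. }
      assert (W <= 2 * PI) by nra.
      destruct (Req_dec W (2 * PI)) as [|Hne]; auto. exfalso.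
      (* If [W < 2 * PI], then [W / 2] lies in the open interval from 0 to [PI], so
         [cos W = 1 - 2 * sin (W / 2) ^ 2 < 1], a contradiction. *)
      assert (0 < sin (W / 2)) by (apply sin_gt_0; lra).
      replace W with (2 * (W / 2)) in cosW by field. rewrite cos_2a_sin in cosW. nra.
Qed.

Lemma continuous_nonvanishing_sign (w : R -> R) :
  continuity w -> (forall u, w u <> 0) -> (forall u, 0 < w u) \/ (forall u, w u < 0).
Proof.
  intros cw Hw.
  assert (H : forall s t, 0 < w s -> w t < 0 -> False).
  { intros s t Hs Ht. destruct (IVT_gen w s t 0 cw) as (z & _ & Hz).
    - rewrite Rmin_right, Rmax_left; lra.
    - exact (Hw z Hz). }
  destruct (Rtotal_order (w 0) 0) as [H0|[H0|H0]].
  - right. intros u. destruct (Rtotal_order (w u) 0) as [|[|]]; auto;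
      [now destruct (Hw u)|now destruct (H u 0)].
  - now destruct (Hw 0).
  - left. intros u. destruct (Rtotal_order (w u) 0) as [|[|]]; auto;
      [now destruct (H 0 u)|now destruct (Hw u)].
Qed.

(** The turning rate has constant sign. When it is negative, reflection in the horizontal axis
    reverses it and leads back to the positive case. *)
Lemma total_absolute_curvature_simple (x y a b v w : R -> R) (P : R) :
  0 < P ->
  (forall u, is_derive x u (v u * a u)) -> (forall u, is_derive y u (v u * b u)) ->
  (forall u, 0 < v u) -> (forall u, a u * a u + b u * b u = 1) ->
  (forall u, is_derive a u (- w u * b u)) -> (forall u, is_derive b u (w u * a u)) ->
  continuity w -> (forall u, w u <> 0) ->
  (forall u, x (u + P) = x u) -> (forall u, y (u + P) = y u) ->
  (forall u, a (u + P) = a u) -> (forall u, b (u + P) = b u) ->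
  (forall u, w (u + P) = w u) ->
  (forall s t, x s = x t -> y s = y t -> exists z : Z, s = t + P * IZR z) ->
  RInt (fun u => Rabs (w u)) 0 P = 2 * PI.
Proof.
  intros HP Hx Hy Hv Hab Ha Hb cw Hw px py pa pb pw Hinj.
  destruct (continuous_nonvanishing_sign w cw Hw) as [Hpos|Hneg].
  - rewrite (RInt_ext _ w) by (intros; rewrite Rabs_pos_eq; auto; now apply Rlt_le).
    now apply (total_curvature_simple_locally_convex x y a b v w).
  - rewrite (RInt_ext _ (fun u => - w u)) by (intros; now apply Rabs_left).
    apply (total_curvature_simple_locally_convex x (fun u => - y u) a (fun u => - b u) v
      (fun u => - w u)); auto.
    + intros u. evar_last; [apply (is_derive_opp (V := R_NormedModule)), Hy|].
      unfold opp; simpl. ring.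
    + intros u. rewrite <- (Hab u). ring.
    + intros u. evar_last; [apply Ha|]. ring.
    + intros u. evar_last; [apply (is_derive_opp (V := R_NormedModule)), Hb|].
      unfold opp; simpl. ring.
    + intros u. apply continuity_pt_opp, cw.
    + intros u. specialize (Hneg u). lra.
    + intros u. now rewrite py.
    + intros u. now rewrite pb.
    + intros u. now rewrite pw.
    + intros s t Es Et. apply Hinj; lra.
Qed.

(** * Derivatives relative to an interval *)

Definition jointly_continuous_on (J : R -> Prop) (g : R -> R -> R) : Prop :=
  forall t u, J t ->
    filterlim (fun p : R * R => g (fst p) (snd p))
      (within (fun p : R * R => J (fst p)) (locally (t, u))) (locally (g t u)).

Lemma jointly_continuous_on_dist (J : R -> Prop) (g : R -> R -> R) (t u : R) (eps : posreal) :
  jointly_continuous_on J g -> J t ->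
  exists d : posreal, forall s v, J s -> Rabs (s - t) < d -> Rabs (v - u) < d ->
    Rabs (g s v - g t u) < eps.
Proof.
  intros Hg Jt.
  destruct (proj1 (filterlim_locally _ _) (Hg t u Jt) eps) as [d Hd].
  exists d. intros s v Js Hs Hv. apply (Hd (s, v)); auto. split; auto.
Qed.

Lemma jointly_continuous_on_snd (J : R -> Prop) (g : R -> R -> R) (t : R) :
  jointly_continuous_on J g -> J t -> continuity (g t).
Proof.
  intros Hg Jt u. apply continuity_pt_locally. intros eps.
  destruct (jointly_continuous_on_dist J g t u eps Hg Jt) as [d Hd].
  exists d. intros v Hv. apply Hd; auto. rewrite Rminus_diag. rewrite Rabs_R0. apply cond_pos.
Qed.

Lemma jointly_continuous_on_comp (J : R -> Prop) (f : R -> R) (g : R -> R -> R) :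
  jointly_continuous_on J g -> (forall t u, J t -> continuity_pt f (g t u)) ->
  jointly_continuous_on J (fun t u => f (g t u)).
Proof.
  intros Hg Hf t u Jt.
  apply (filterlim_comp _ _ _ (fun p => g (fst p) (snd p)) f _ (locally (g t u))).
  - now apply Hg.
  - now apply continuity_pt_filterlim, Hf.
Qed.

Lemma jointly_continuous_on_plus (J : R -> Prop) (f g : R -> R -> R) :
  jointly_continuous_on J f -> jointly_continuous_on J g ->
  jointly_continuous_on J (fun t u => f t u + g t u).
Proof.
  intros Hf Hg t u Jt.
  eapply filterlim_comp_2; [now apply Hf|now apply Hg|].
  apply (filterlim_plus (V := R_NormedModule)).
Qed.

Lemma jointly_continuous_on_mult (J : R -> Prop) (f g : R -> R -> R) :
  jointly_continuous_on J f -> jointly_continuous_on J g ->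
  jointly_continuous_on J (fun t u => f t u * g t u).
Proof.
  intros Hf Hg t u Jt.
  eapply filterlim_comp_2; [now apply Hf|now apply Hg|].
  apply (filterlim_mult (K := R_AbsRing)).
Qed.

(** Compactness of [[a, b]]: joint continuity at each [(t, v)] gives a radius [delta v], and a
    common lower bound for the radii near each [u] suffices. Both values are compared with [g t v],
    whence [eps / 2]. *)
Lemma jointly_continuous_on_uniform (J : R -> Prop) (g : R -> R -> R) (t a b : R) (eps : posreal) :
  jointly_continuous_on J g -> J t ->
  exists d : posreal, forall s u, J s -> Rabs (s - t) < d -> a <= u <= b ->
    Rabs (g s u - g t u) < eps.
Proof.
  intros Hg Jt.
  assert (He : 0 < eps / 2) by (pose proof (cond_pos eps); lra).
  set (P := fun u (d : posreal) => forall s v, J s -> Rabs (s - t) < d -> Rabs (v - u) < d ->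
    Rabs (g s v - g t u) < eps / 2).
  assert (HP : forall u, exists d, P u d)
    by (intros u; apply (jointly_continuous_on_dist J g t u (mkposreal _ He)); auto).
  set (delta := fun u => proj1_sig (constructive_indefinite_description _ (HP u))).
  assert (Hdelta : forall u, P u (delta u)).
  { intros u. unfold delta. now destruct (constructive_indefinite_description _ _). }
  destruct (compactness_value_1d a b delta) as [d Hd].
  exists d. intros s u Js Hs Hu.
  (* Compactness supplies the centre [v] near [u] only under a double negation, so a contradiction
     is sought. *)
  destruct (Rlt_le_dec (Rabs (g s u - g t u)) eps) as [|Hle]; auto.
  exfalso. apply (Hd u Hu). intros (v & _ & Huv & Hdv).
  pose proof (Hdelta v s u Js ltac:(lra) Huv) as H1.
  pose proof (Hdelta v t u Jt ltac:(rewrite Rminus_diag, Rabs_R0; apply cond_pos) Huv) as H2.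
  apply Rabs_lt_between in H1, H2.
  apply (Rlt_not_le _ _ (proj2 (Rabs_lt_between (g s u - g t u) eps) ltac:(lra)) Hle).
Qed.

Lemma interval_interior (J : R -> Prop) (a b x : R) :
  nondegenerate_interval J -> J a -> J b -> a < x < b -> locally x J.
Proof.
  intros [HJ _] Ja Jb Hx.
  assert (Hd : 0 < Rmin (x - a) (b - x)) by (apply Rmin_glb_lt; lra).
  exists (mkposreal _ Hd). intros y Hy. apply (HJ a b); auto.
  unfold ball in Hy; simpl in Hy; unfold AbsRing_ball, abs, minus, plus, opp in Hy; simpl in Hy.
  pose proof (Rmin_l (x - a) (b - x)). pose proof (Rmin_r (x - a) (b - x)).
  apply Rabs_lt_between in Hy. lra.
Qed.

(* The function is composed with the retraction onto the segment from [s] to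
   [t], as it need not be continuous from both sides at an endpoint of [J]. *)
Lemma mean_value_on (J : R -> Prop) (g dg : R -> R -> R) (u s t : R) :
  nondegenerate_interval J -> jointly_continuous_on J g ->
  (forall r, locally r J -> is_derive (fun r => g r u) r (dg r u)) ->
  J s -> J t ->
  exists c, Rmin t s <= c <= Rmax t s /\ J c /\ g s u - g t u = dg c u * (s - t).
Proof.
  intros HJ Hg Hdg Js Jt.
  set (m := Rmin t s). set (M := Rmax t s).
  assert (HmM : J m /\ J M /\ m <= M).
  { unfold m, M, Rmin, Rmax. destruct (Rle_dec t s); repeat split; auto; lra. }
  destruct HmM as (Jm & JM & HmM).
  set (cl := fun x => Rmax m (Rmin x M)).
  assert (Hcl : forall x, m <= x <= M -> cl x = x).
  { intros x Hx. unfold cl. rewrite Rmin_left, Rmax_right; lra. }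
  assert (Hbd : forall x, m <= cl x <= M).
  { intros x. unfold cl. split; [apply Rmax_l|]. apply Rmax_lub; auto. apply Rmin_r. }
  assert (Jcl : forall x, J (cl x)) by (intros x; apply (proj1 HJ m M); auto).
  assert (lip : forall x y, Rabs (cl y - cl x) <= Rabs (y - x)).
  { intros x y. unfold cl, Rmax, Rmin.
    repeat destruct (Rle_dec _ _); unfold Rabs; repeat destruct (Rcase_abs _); lra. }
  destruct (MVT_gen (fun r => g (cl r) u) t s (fun r => dg r u)) as (c & Hc & E).
  - fold m M. intros x Hx. apply (is_derive_ext_loc (fun r => g r u)).
    + assert (Hd : 0 < Rmin (x - m) (M - x)) by (apply Rmin_glb_lt; lra).
      exists (mkposreal _ Hd). intros y Hy.
      unfold ball in Hy; simpl in Hy; unfold AbsRing_ball, abs, minus, plus, opp in Hy; simpl in Hy.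
      pose proof (Rmin_l (x - m) (M - x)). pose proof (Rmin_r (x - m) (M - x)).
      apply Rabs_lt_between in Hy. rewrite Hcl; auto. lra.
    + apply Hdg. now apply (interval_interior J m M).
  - intros x _. apply continuity_pt_locally. intros eps.
    destruct (jointly_continuous_on_dist J g (cl x) u eps Hg (Jcl x)) as [d Hd].
    exists d. intros y Hy. apply Hd; auto.
    + eapply Rle_lt_trans; [apply lip|exact Hy].
    + rewrite Rminus_diag, Rabs_R0. apply cond_pos.
  - exists c. cbv beta in E. fold m M in Hc. rewrite !Hcl in E.
    + repeat split; try apply Hc; auto. apply (proj1 HJ m M); auto.
    + unfold m, M. split; [apply Rmin_l|apply Rmax_l].
    + unfold m, M. split; [apply Rmin_r|apply Rmax_r].
Qed.

(** Differentiation under the integral sign: the mean value theorem turns the difference quotient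
    into [dg] at an intermediate time, which is uniformly close to [dg t]. Derivatives at interior
    times suffice, also when [t] is an endpoint of [J]. *)
Lemma is_derive_on_RInt_param (J : R -> Prop) (g dg : R -> R -> R) (a b t : R) :
  nondegenerate_interval J -> a <= b ->
  jointly_continuous_on J g -> jointly_continuous_on J dg ->
  (forall r u, locally r J -> is_derive (fun r => g r u) r (dg r u)) ->
  J t ->
  is_derive_on (V := R_NormedModule) J (fun s => RInt (g s) a b) t (RInt (dg t) a b).
Proof.
  intros HJ Hab Hg Hdg Hd Jt. unfold is_derive_on.
  apply filterlim_locally. intros eps.
  (* The added 1 keeps the denominator positive when [a = b] and the final estimate strict. *)
  assert (He : 0 < eps / (b - a + 1)) by (apply Rdiv_lt_0_compat; [apply cond_pos|lra]).
  destruct (jointly_continuous_on_uniform J dg t a b (mkposreal _ He) Hdg Jt) as [d Hu].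
  exists d. intros s Hs [Js Hst].
  assert (Hs' : Rabs (s - t) < d) by exact Hs.
  assert (HI : forall h r, jointly_continuous_on J h -> J r -> is_RInt (h r) a b (RInt (h r) a b)).
  { intros h r Hh Jr. apply (RInt_correct (V := R_CompleteNormedModule)).
    apply continuity_ex_RInt. now apply (jointly_continuous_on_snd J). }
  assert (E : is_RInt (fun u => / (s - t) * (g s u - g t u) - dg t u) a b
    (/ (s - t) * (RInt (g s) a b - RInt (g t) a b) - RInt (dg t) a b)).
  { apply (is_RInt_minus (V := R_NormedModule)); [|now apply HI].
    apply (is_RInt_scal (V := R_NormedModule)).
    apply (is_RInt_minus (V := R_NormedModule)); now apply HI. }
  change (Rabs (/ (s - t) * (RInt (g s) a b - RInt (g t) a b) - RInt (dg t) a b) < eps).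
  rewrite <- (is_RInt_unique _ _ _ _ E).
  apply Rle_lt_trans with ((b - a) * (eps / (b - a + 1))).
  - apply abs_RInt_le_const; auto.
    + eexists; exact E.
    + intros u Hu'. destruct (mean_value_on J g dg u s t) as (c & Hc & Jc & Ec); auto.
      rewrite Ec. replace (/ (s - t) * (dg c u * (s - t)) - dg t u) with (dg c u - dg t u)
        by (field; lra).
      left. apply Hu; auto. eapply Rle_lt_trans; [|exact Hs'].
      revert Hc. unfold Rmin, Rmax. destruct (Rle_dec t s); intros Hc;
        unfold Rabs; repeat destruct (Rcase_abs _); lra.
  - apply Rlt_le_trans with ((b - a + 1) * (eps / (b - a + 1))).
    + apply Rmult_lt_compat_r; auto. lra.
    + right. field. lra.
Qed.

(** * Components and uniqueness of derivatives *)

Lemma is_derive_fst (c : R -> R * R) (t : R) (l : R * R) :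
  is_derive c t l -> is_derive (fun s => fst (c s)) t (fst l).
Proof.
  intros H.
  apply (filterdiff_comp' (U := R_NormedModule) (V := prod_NormedModule _ R_NormedModule R_NormedModule)
    (W := R_NormedModule) c (fun p => fst p) t (fun y => scal y l) (fun p => fst p) H).
  apply filterdiff_linear, is_linear_fst.
Qed.

Lemma is_derive_snd (c : R -> R * R) (t : R) (l : R * R) :
  is_derive c t l -> is_derive (fun s => snd (c s)) t (snd l).
Proof.
  intros H.
  apply (filterdiff_comp' (U := R_NormedModule) (V := prod_NormedModule _ R_NormedModule R_NormedModule)
    (W := R_NormedModule) c (fun p => snd p) t (fun y => scal y l) (fun p => snd p) H).
  apply filterdiff_linear, is_linear_snd.
Qed.

Lemma is_derive_on_fst (J : R -> Prop) (c : R -> R * R) (t : R) (l : R * R) :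
  is_derive_on J c t l -> is_derive_on (V := R_NormedModule) J (fun s => fst (c s)) t (fst l).
Proof.
  intros H. unfold is_derive_on in *.
  apply (filterlim_comp _ _ _ _ (fun p : R * R => fst p) _ _ _ H).
  destruct l; apply continuous_fst.
Qed.

Lemma is_derive_on_snd (J : R -> Prop) (c : R -> R * R) (t : R) (l : R * R) :
  is_derive_on J c t l -> is_derive_on (V := R_NormedModule) J (fun s => snd (c s)) t (snd l).
Proof.
  intros H. unfold is_derive_on in *.
  apply (filterlim_comp _ _ _ _ (fun p : R * R => snd p) _ _ _ H).
  destruct l; apply continuous_snd.
Qed.

Lemma is_derive_on_interior (J : R -> Prop) (f : R -> R) (t l : R) :
  locally t J -> is_derive_on (V := R_NormedModule) J f t l -> is_derive f t l.
Proof.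
  intros [d1 HJ] H. apply is_derive_Reals. intros eps Heps.
  destruct (proj1 (filterlim_locally _ _) H (mkposreal _ Heps)) as [d2 Hd].
  pose proof (cond_pos d1). pose proof (cond_pos d2).
  assert (Hm : 0 < Rmin d1 d2) by now apply Rmin_glb_lt.
  exists (mkposreal _ Hm). intros h Hh Hhd. simpl in Hhd.
  pose proof (Rmin_l d1 d2). pose proof (Rmin_r d1 d2).
  assert (E : Rabs (t + h - t) = Rabs h) by (f_equal; ring).
  specialize (Hd (t + h)).
  assert (Hq : Rabs (/ (t + h - t) * (f (t + h) - f t) - l) < eps).
  { apply Hd.
    - change (Rabs (t + h - t) < d2). lra.
    - split; [|lra]. apply HJ. change (Rabs (t + h - t) < d1). lra. }
  replace ((f (t + h) - f t) / h - l) with (/ (t + h - t) * (f (t + h) - f t) - l); auto.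
  replace (t + h - t) with h by ring. unfold Rdiv. ring.
Qed.

(** A nondegenerate interval contains points arbitrarily close to [t] on at least one side, so the
    filter in the definition is proper and limits are unique. *)
Lemma is_derive_on_unique (J : R -> Prop) (f : R -> R * R) (t : R) (l1 l2 : R * R) :
  nondegenerate_interval J -> J t ->
  is_derive_on J f t l1 -> is_derive_on J f t l2 -> l1 = l2.
Proof.
  intros [HJ (a & b & Ja & Jb & Hab)] Jt H1 H2.
  assert (PF : ProperFilter' (within (fun s : R => J s /\ s <> t) (locally t))).
  { constructor; [|apply within_filter, locally_filter].
    intros [d Hd]. pose proof (cond_pos d).
    destruct (Rlt_le_dec t b) as [Htb|Hbt].
    - assert (0 < Rmin d (b - t)) by (apply Rmin_glb_lt; lra).
      pose proof (Rmin_l d (b - t)). pose proof (Rmin_r d (b - t)).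
      apply (Hd (t + Rmin d (b - t) / 2)).
      + change (Rabs (t + Rmin d (b - t) / 2 - t) < d).
        rewrite Rabs_pos_eq; lra.
      + split; [|lra]. apply (HJ t b); auto. lra.
    - assert (0 < Rmin d (t - a)) by (apply Rmin_glb_lt; lra).
      pose proof (Rmin_l d (t - a)). pose proof (Rmin_r d (t - a)).
      apply (Hd (t - Rmin d (t - a) / 2)).
      + change (Rabs (t - Rmin d (t - a) / 2 - t) < d).
        rewrite Rabs_left; lra.
      + split; [|lra]. apply (HJ a t); auto. lra. }
  apply (filterlim_locally_unique (V := prod_NormedModule _ R_NormedModule R_NormedModule) _ _ _ H1 H2).
Qed.

(** * Geometry of a fixed curve *)

Lemma is_derive_euclidean_norm (x y : R -> R) (t dx dy : R) :
  is_derive x t dx -> is_derive y t dy -> 0 < x t * x t + y t * y t ->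
  is_derive (fun s => sqrt (x s * x s + y s * y s)) t
    ((x t * dx + y t * dy) / sqrt (x t * x t + y t * y t)).
Proof.
  intros Hx Hy Hpos.
  evar_last; [apply (is_derive_sqrt (fun s => x s * x s + y s * y s)); [|exact Hpos]|].
  - apply (is_derive_plus (V := R_NormedModule)); apply is_derive_Rmult; eassumption.
  - apply sqrt_lt_R0 in Hpos. unfold plus; simpl. field. lra.
Qed.

Lemma is_derive_periodic (f df : R -> R) (P : R) :
  (forall u, is_derive f u (df u)) -> (forall u, f (u + P) = f u) ->
  forall u, df (u + P) = df u.
Proof.
  intros Hf HP u. rewrite <- (is_derive_unique _ _ _ (Hf u)). symmetry.
  apply is_derive_unique. apply (is_derive_ext (fun t => f (P + t))).
  - intros t. rewrite <- (HP t). f_equal. apply Rplus_comm.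
  - apply is_derive_translate. rewrite Rplus_comm. apply Hf.
Qed.

Definition C2_curve (c : R -> R * R) (x1 y1 x2 y2 : R -> R) : Prop :=
  (forall u, is_derive (fun v => fst (c v)) u (x1 u)) /\
  (forall u, is_derive (fun v => snd (c v)) u (y1 u)) /\
  (forall u, is_derive x1 u (x2 u)) /\ (forall u, is_derive y1 u (y2 u)) /\
  continuity x2 /\ continuity y2.

Definition unit_normal (c N : R -> R * R) : Prop :=
  forall u, dot (N u) (N u) = 1 /\ dot (N u) (velocity c u) = 0.

(** The derivative in [u] of the tangent angle, that is, signed curvature times speed. *)
Definition turning_rate (x1 y1 x2 y2 : R -> R) (u : R) : R :=
  (x1 u * y2 u - y1 u * x2 u) / (x1 u * x1 u + y1 u * y1 u).

Lemma velocity_C2 (c : R -> R * R) (x1 y1 x2 y2 : R -> R) (u : R) :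
  C2_curve c x1 y1 x2 y2 -> velocity c u = (x1 u, y1 u).
Proof.
  intros (Hx & Hy & _). unfold velocity.
  f_equal; apply is_derive_unique; auto.
Qed.

Lemma speed_C2 (c : R -> R * R) (x1 y1 x2 y2 : R -> R) (u : R) :
  C2_curve c x1 y1 x2 y2 -> speed c u = sqrt (x1 u * x1 u + y1 u * y1 u).
Proof. intros H. unfold speed. now rewrite (velocity_C2 _ _ _ _ _ _ H). Qed.

Lemma speed_C2_pos (c : R -> R * R) (x1 y1 x2 y2 : R -> R) (u : R) :
  C2_curve c x1 y1 x2 y2 -> velocity c u <> (0, 0) ->
  0 < x1 u * x1 u + y1 u * y1 u /\ 0 < speed c u /\
  speed c u * speed c u = x1 u * x1 u + y1 u * y1 u.
Proof.
  intros H Hv. rewrite (velocity_C2 _ _ _ _ _ _ H) in Hv. rewrite (speed_C2 _ _ _ _ _ _ H).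
  assert (Hpos : 0 < x1 u * x1 u + y1 u * y1 u).
  { destruct (Req_dec (x1 u) 0) as [Ex|]; [|nra].
    destruct (Req_dec (y1 u) 0) as [Ey|]; [|nra].
    destruct Hv. now rewrite Ex, Ey. }
  repeat split; auto.
  - now apply sqrt_lt_R0.
  - apply sqrt_sqrt. lra.
Qed.

(** The Frenet equations in the parameter [u]: the unit tangent is rotated by a quarter turn and
    scaled by the turning rate. *)
Lemma is_derive_tangent (c : R -> R * R) (x1 y1 x2 y2 : R -> R) (u : R) :
  C2_curve c x1 y1 x2 y2 -> (forall u, velocity c u <> (0, 0)) ->
  is_derive (fun v => fst (tangent c v)) u
    (- turning_rate x1 y1 x2 y2 u * snd (tangent c u)) /\
  is_derive (fun v => snd (tangent c v)) u
    (turning_rate x1 y1 x2 y2 u * fst (tangent c u)).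
Proof.
  intros H Hv. destruct (speed_C2_pos _ _ _ _ _ u H (Hv u)) as (Hpos & Hs & Hs2).
  pose proof H as (_ & _ & Hx1 & Hy1 & _).
  assert (Hd : is_derive (speed c) u ((x1 u * x2 u + y1 u * y2 u) / speed c u)).
  { rewrite (speed_C2 _ _ _ _ _ _ H).
    apply (is_derive_ext (fun s => sqrt (x1 s * x1 s + y1 s * y1 s))).
    - intros t. symmetry. apply (speed_C2 _ _ _ _ _ _ H).
    - apply is_derive_euclidean_norm; auto. }
  unfold turning_rate. rewrite <- Hs2.
  assert (HT : forall t, tangent c t = (x1 t / speed c t, y1 t / speed c t)).
  { intros t. unfold tangent. now rewrite (velocity_C2 _ _ _ _ _ _ H). }
  rewrite (HT u). cbn [fst snd]. split.
  - apply (is_derive_ext (fun s => x1 s / speed c s)).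
    + intros t. now rewrite HT.
    + evar_last; [apply is_derive_div; [apply Hx1|exact Hd|lra]|].
      (* Expanding the squared speed in the numerator cancels [x1^2 x2] and leaves
         [- y1 (x1 y2 - y1 x2)]. *)
      transitivity ((x2 u * (speed c u * speed c u) - x1 u * (x1 u * x2 u + y1 u * y2 u)) / speed c u ^ 3);
        [field; lra|rewrite Hs2 at 1; field; lra].
  - apply (is_derive_ext (fun s => y1 s / speed c s)).
    + intros t. now rewrite HT.
    + evar_last; [apply is_derive_div; [apply Hy1|exact Hd|lra]|].
      transitivity ((y2 u * (speed c u * speed c u) - y1 u * (x1 u * x2 u + y1 u * y2 u)) / speed c u ^ 3);
        [field; lra|rewrite Hs2 at 1; field; lra].
Qed.

Lemma tangent_unit (c : R -> R * R) (u : R) :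
  0 < speed c u -> dot (tangent c u) (tangent c u) = 1.
Proof.
  intros Hs. unfold tangent, dot; cbn [fst snd].
  assert (E : speed c u * speed c u = dot (velocity c u) (velocity c u)).
  { unfold speed. apply sqrt_sqrt. unfold dot. nra. }
  unfold dot in E.
  transitivity ((speed c u * speed c u) / (speed c u * speed c u)); [|field; lra].
  rewrite E at 1. field. lra.
Qed.

Lemma curvature_speed (c N : R -> R * R) (u : R) (x1 y1 x2 y2 : R -> R) :
  C2_curve c x1 y1 x2 y2 -> (forall u, velocity c u <> (0, 0)) ->
  curvature c N u * speed c u = turning_rate x1 y1 x2 y2 u *
    (fst (tangent c u) * snd (N u) - snd (tangent c u) * fst (N u)).
Proof.
  intros H Hv. destruct (speed_C2_pos _ _ _ _ _ u H (Hv u)) as (_ & Hs & _).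
  destruct (is_derive_tangent _ _ _ _ _ u H Hv) as [Da Db].
  apply is_derive_unique in Da, Db.
  assert (E : velocity (tangent c) u = (- turning_rate x1 y1 x2 y2 u * snd (tangent c u),
    turning_rate x1 y1 x2 y2 u * fst (tangent c u))) by (unfold velocity; f_equal; assumption).
  unfold curvature. rewrite E. unfold dot; simpl. field. lra.
Qed.

(** Tangent and normal are orthonormal, so their determinant [e] is 1 or -1; positivity of the
    curvature selects the absolute value. *)
Lemma curvature_speed_abs (c N : R -> R * R) (u : R) (x1 y1 x2 y2 : R -> R) :
  C2_curve c x1 y1 x2 y2 -> (forall u, velocity c u <> (0, 0)) ->
  unit_normal c N -> 0 < curvature c N u ->
  curvature c N u * speed c u = Rabs (turning_rate x1 y1 x2 y2 u).
Proof.
  intros H Hv HN Hk. destruct (speed_C2_pos _ _ _ _ _ u H (Hv u)) as (_ & Hs & _).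
  pose proof (curvature_speed c N u _ _ _ _ H Hv) as E.
  assert (Hks : 0 < curvature c N u * speed c u) by now apply Rmult_lt_0_compat.
  pose proof (tangent_unit c u Hs) as HT. destruct (HN u) as [N1 NV].
  assert (NT : fst (N u) * fst (tangent c u) + snd (N u) * snd (tangent c u) = 0).
  { unfold tangent; cbn [fst snd]. unfold dot in NV.
    transitivity ((fst (N u) * fst (velocity c u) + snd (N u) * snd (velocity c u)) / speed c u).
    - field. lra.
    - rewrite NV. field. lra. }
  unfold dot in HT, N1.
  set (e := fst (tangent c u) * snd (N u) - snd (tangent c u) * fst (N u)) in *.
  (* Lagrange's identity *)
  assert (He : e * e = 1).
  { transitivity ((fst (tangent c u) * fst (tangent c u) + snd (tangent c u) * snd (tangent c u)) *
      (fst (N u) * fst (N u) + snd (N u) * snd (N u)) -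
      (fst (N u) * fst (tangent c u) + snd (N u) * snd (tangent c u)) *
      (fst (N u) * fst (tangent c u) + snd (N u) * snd (tangent c u))).
    - unfold e. ring.
    - rewrite HT, N1, NT. ring. }
  rewrite <- (Rabs_pos_eq (curvature c N u * speed c u)) by lra.
  rewrite E, Rabs_mult.
  assert (E1 : Rabs e * Rabs e = 1) by (rewrite <- Rabs_mult, He; apply Rabs_R1).
  pose proof (Rabs_pos e). replace (Rabs e) with 1 by nra. ring.
Qed.

Lemma turning_rate_continuity (c : R -> R * R) (x1 y1 x2 y2 : R -> R) :
  C2_curve c x1 y1 x2 y2 -> (forall u, velocity c u <> (0, 0)) ->
  continuity (turning_rate x1 y1 x2 y2).
Proof.
  intros H Hv u. destruct (speed_C2_pos _ _ _ _ _ u H (Hv u)) as (Hpos & _).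
  destruct H as (_ & _ & Hx & Hy & cx & cy).
  assert (cx1 : continuity_pt x1 u) by eapply is_derive_continuity_pt, Hx.
  assert (cy1 : continuity_pt y1 u) by eapply is_derive_continuity_pt, Hy.
  apply (continuity_pt_div (fun u => x1 u * y2 u - y1 u * x2 u)
    (fun u => x1 u * x1 u + y1 u * y1 u)).
  - apply (continuity_pt_minus (fun u => x1 u * y2 u) (fun u => y1 u * x2 u));
      now apply continuity_pt_mult.
  - apply (continuity_pt_plus (fun u => x1 u * x1 u) (fun u => y1 u * y1 u));
      now apply continuity_pt_mult.
  - lra.
Qed.

(** Positive curvature makes the integrand the absolute value of a nowhere vanishing turning rate,
    so the result on simple curves applies with period [2 * PI]. *)
Lemma total_curvature_convex (c N : R -> R * R) (x1 y1 x2 y2 : R -> R) :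
  C2_curve c x1 y1 x2 y2 -> regular_simple_closed c -> unit_normal c N ->
  (forall u, 0 < curvature c N u) ->
  arc_integral c (curvature c N) = 2 * PI.
Proof.
  intros H (Hper & Hv & Hinj) HN Hk. unfold arc_integral.
  rewrite (RInt_ext _ (fun u => Rabs (turning_rate x1 y1 x2 y2 u)))
    by (intros; now apply curvature_speed_abs).
  assert (Hs : forall u, 0 < speed c u) by (intros u; now apply (speed_C2_pos _ _ _ _ _ u H)).
  assert (px : forall u, fst (c (u + 2 * PI)) = fst (c u)) by (intros; now rewrite Hper).
  assert (py : forall u, snd (c (u + 2 * PI)) = snd (c u)) by (intros; now rewrite Hper).
  pose proof H as (Hx & Hy & Hx1 & Hy1 & _).
  assert (px1 := is_derive_periodic _ _ _ Hx px). assert (py1 := is_derive_periodic _ _ _ Hy py).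
  assert (px2 := is_derive_periodic _ _ _ Hx1 px1). assert (py2 := is_derive_periodic _ _ _ Hy1 py1).
  assert (pt : forall u, tangent c (u + 2 * PI) = tangent c u).
  { intros u. unfold tangent. rewrite !(speed_C2 _ _ _ _ _ _ H), !(velocity_C2 _ _ _ _ _ _ H).
    now rewrite px1, py1. }
  assert (Ht : forall u, x1 u = speed c u * fst (tangent c u) /\ y1 u = speed c u * snd (tangent c u)).
  { intros u. unfold tangent. rewrite (velocity_C2 _ _ _ _ _ _ H). simpl.
    specialize (Hs u). split; field; lra. }
  apply (total_absolute_curvature_simple (fun u => fst (c u)) (fun u => snd (c u))
    (fun u => fst (tangent c u)) (fun u => snd (tangent c u)) (speed c)); auto.
  - pose proof PI_RGT_0. lra.
  - intros u. rewrite <- (proj1 (Ht u)). apply Hx.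
  - intros u. rewrite <- (proj2 (Ht u)). apply Hy.
  - intros u. now apply tangent_unit.
  - intros u. now apply (is_derive_tangent _ _ _ _ _ u H).
  - intros u. now apply (is_derive_tangent _ _ _ _ _ u H).
  - now apply (turning_rate_continuity c).
  - intros u E. pose proof (curvature_speed_abs c N u _ _ _ _ H Hv HN (Hk u)) as E'.
    rewrite E, Rabs_R0 in E'. specialize (Hk u). specialize (Hs u). nra.
  - intros u. now rewrite pt.
  - intros u. now rewrite pt.
  - intros u. unfold turning_rate. now rewrite px1, py1, px2, py2.
  - intros s t Es Et. apply Hinj. now apply injective_projections.
Qed.

(** * Continuity along the curve and the Cauchy-Schwarz estimate *)

Lemma speed_continuity (c : R -> R * R) (x1 y1 x2 y2 : R -> R) :
  C2_curve c x1 y1 x2 y2 -> (forall u, velocity c u <> (0, 0)) -> continuity (speed c).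
Proof.
  intros H Hv u. destruct (speed_C2_pos _ _ _ _ _ u H (Hv u)) as (Hpos & _).
  pose proof H as (_ & _ & Hx1 & Hy1 & _).
  apply (is_derive_continuity_pt _ _ ((x1 u * x2 u + y1 u * y2 u) / sqrt (x1 u * x1 u + y1 u * y1 u))).
  apply (is_derive_ext (fun s => sqrt (x1 s * x1 s + y1 s * y1 s))).
  - intros t. symmetry. apply (speed_C2 _ _ _ _ _ _ H).
  - apply is_derive_euclidean_norm; auto.
Qed.

(** [unit_normal] says nothing about continuity of [N], so continuity is read off from the quotient
    of the absolute turning rate by the speed. *)
Lemma curvature_continuity (c N : R -> R * R) (x1 y1 x2 y2 : R -> R) :
  C2_curve c x1 y1 x2 y2 -> (forall u, velocity c u <> (0, 0)) -> unit_normal c N ->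
  (forall u, 0 < curvature c N u) -> continuity (curvature c N).
Proof.
  intros H Hv HN Hk.
  assert (Hs : forall u, 0 < speed c u) by (intros u; now apply (speed_C2_pos _ _ _ _ _ u H)).
  intros u. apply continuity_pt_ext with (fun u => Rabs (turning_rate x1 y1 x2 y2 u) / speed c u).
  - intros t. rewrite <- (curvature_speed_abs c N t _ _ _ _ H) by auto.
    specialize (Hs t). field. lra.
  - apply (continuity_pt_div (fun u => Rabs (turning_rate x1 y1 x2 y2 u)) (speed c)).
    + apply (continuity_pt_comp _ Rabs); [now apply (turning_rate_continuity c)|apply Rcontinuity_abs].
    + now apply (speed_continuity c x1 y1 x2 y2).
    + specialize (Hs u). lra.
Qed.

Lemma is_RInt_arc_integral (c : R -> R * R) (f : R -> R) :
  continuity (speed c) -> continuity f ->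
  is_RInt (fun u => f u * speed c u) 0 (2 * PI) (arc_integral c f).
Proof.
  intros cs cf. apply (RInt_correct (V := R_CompleteNormedModule)), continuity_ex_RInt.
  now apply continuity_mult.
Qed.

(* Cauchy-Schwarz in the form [1/k + m^2 k >= 2 m] with [m = L / (2 pi)]. *)
Lemma length_sqr_le_convex (c N : R -> R * R) (x1 y1 x2 y2 : R -> R) :
  C2_curve c x1 y1 x2 y2 -> regular_simple_closed c -> unit_normal c N ->
  (forall u, 0 < curvature c N u) ->
  arc_length c * arc_length c <= 2 * PI * arc_integral c (fun u => 1 / curvature c N u).
Proof.
  intros H Hc HN Hk. pose proof (total_curvature_convex c N _ _ _ _ H Hc HN Hk) as HK.
  destruct Hc as (_ & Hv & _). pose proof PI_RGT_0 as Hpi.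
  assert (Hs : forall u, 0 < speed c u) by (intros u; now apply (speed_C2_pos _ _ _ _ _ u H)).
  pose proof (speed_continuity _ _ _ _ _ H Hv) as cs.
  pose proof (curvature_continuity c N _ _ _ _ H Hv HN Hk) as ck.
  set (L := arc_length c). set (I := arc_integral c (fun u => 1 / curvature c N u)).
  assert (ex := fun f => is_RInt_arc_integral c f cs).
  assert (c1 : continuity (fun _ => 1)) by now apply continuity_const.
  assert (ci : continuity (fun u => 1 / curvature c N u)).
  { intros u. apply (continuity_pt_div (fun _ => 1) (curvature c N)); auto.
    specialize (Hk u). lra. }
  set (m := L / (2 * PI)).
  assert (Hle : 2 * m * L <= I + m * m * (2 * PI)).
  { rewrite <- HK.
    apply (is_RInt_le (fun u => 2 * m * (1 * speed c u))
      (fun u => 1 / curvature c N u * speed c u + m * m * (curvature c N u * speed c u)) 0 (2 * PI)).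
    - lra.
    - apply (is_RInt_scal (V := R_NormedModule) (fun u => 1 * speed c u)). now apply ex.
    - apply (is_RInt_plus (V := R_NormedModule) (fun u => 1 / curvature c N u * speed c u)); [now apply ex|].
      apply (is_RInt_scal (V := R_NormedModule) (fun u => curvature c N u * speed c u)). now apply ex.
    - intros u _. specialize (Hk u). specialize (Hs u).
      (* The square [(1 - m k)^2 / k] expands to [1/k - 2 m + m^2 k]. *)
      assert (0 <= (1 - m * curvature c N u) * (1 - m * curvature c N u) * (speed c u / curvature c N u)).
      { apply Rmult_le_pos; [apply Rle_0_sqr|]. left. now apply Rdiv_lt_0_compat. }
      replace (1 / curvature c N u * speed c u + m * m * (curvature c N u * speed c u)) with
        (2 * m * (1 * speed c u) + (1 - m * curvature c N u) * (1 - m * curvature c N u) * (speed c u / curvature c N u))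
        by (field; lra).
      lra. }
  (* Substituting [L = 2 * PI * m] turns [Hle] into [2 * PI * m^2 <= I]; multiplication by [2 * PI]
     gives the claim. *)
  assert (EL : L = 2 * PI * m) by (unfold m; field; lra).
  rewrite EL in Hle |- *. nra.
Qed.

(** * Evolution of the length *)

Lemma is_derive_on_ext {V : NormedModule R_AbsRing} (J : R -> Prop) (f g : R -> V) (t : R) (l : V) :
  J t -> (forall s, J s -> f s = g s) -> is_derive_on J f t l -> is_derive_on J g t l.
Proof.
  intros Jt E. unfold is_derive_on. apply filterlim_within_ext.
  intros s [Js _]. now rewrite (E s Js), (E t Jt).
Qed.

(* As [W . T = 0] along the curve, [W_u . T = - W . T_u]. *)
Lemma normal_variation_tangential_derivative (c N W : R -> R * R) (x1 y1 x2 y2 dWx dWy : R -> R)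
    (f : R -> R) (u : R) :
  C2_curve c x1 y1 x2 y2 -> (forall u, velocity c u <> (0, 0)) -> unit_normal c N ->
  (forall u, W u = (f u * fst (N u), f u * snd (N u))) ->
  (forall u, is_derive (fun v => fst (W v)) u (dWx u)) ->
  (forall u, is_derive (fun v => snd (W v)) u (dWy u)) ->
  dWx u * fst (tangent c u) + dWy u * snd (tangent c u) =
    - f u * (curvature c N u * speed c u).
Proof.
  intros H Hv HN HW Dx Dy.
  assert (orth : forall v, fst (W v) * fst (tangent c v) + snd (W v) * snd (tangent c v) = 0).
  { intros v. rewrite HW. unfold tangent; cbn [fst snd].
    destruct (HN v) as [_ E]. unfold dot in E.
    transitivity (f v * (fst (N v) * fst (velocity c v) + snd (N v) * snd (velocity c v)) * / speed c v);
      [unfold Rdiv; ring|rewrite E; ring]. }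
  destruct (is_derive_tangent _ _ _ _ _ u H Hv) as [Da Db].
  assert (Z : is_derive (fun v => fst (W v) * fst (tangent c v) + snd (W v) * snd (tangent c v)) u 0).
  { apply (is_derive_ext (fun _ => 0)); [intros v; now rewrite orth|].
    apply (is_derive_const (V := R_NormedModule)). }
  pose proof (is_derive_plus (V := R_NormedModule) _ _ _ _ _
    (is_derive_Rmult _ _ _ _ _ (Dx u) Da) (is_derive_Rmult _ _ _ _ _ (Dy u) Db)) as Z'.
  apply is_derive_unique in Z. apply is_derive_unique in Z'.
  assert (E : dWx u * fst (tangent c u) + fst (W u) * (- turning_rate x1 y1 x2 y2 u * snd (tangent c u))
    + (dWy u * snd (tangent c u) + snd (W u) * (turning_rate x1 y1 x2 y2 u * fst (tangent c u))) = 0)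
    by exact (eq_trans (eq_sym Z') Z).
  rewrite (curvature_speed c N u _ _ _ _ H Hv). rewrite HW in E. cbn [fst snd] in E. lra.
Qed.

Theorem lemma8
  (J : R -> Prop)
  (gamma N : R -> R -> R * R)
  (alpha : R -> R)
  (HJ : nondegenerate_interval J)
  (Hsmooth : smooth_family_on J gamma)
  (Hcurve : forall t : R, J t -> regular_simple_closed (gamma t))
  (HN : forall t : R, J t -> inward_unit_normal (gamma t) (N t))
  (Hconvex : forall t u : R, J t -> 0 < curvature (gamma t) (N t) u)
  (Halpha : smooth_on J alpha)
  (Hflow : forall t u : R, J t ->
     is_derive_on J (fun s : R => gamma s u) t
       (scal (alpha t - 1 / curvature (gamma t) (N t) u) (N t u))) :
  (forall t : R, J t ->
     is_derive_on J (fun s : R => arc_length (gamma s)) t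
       (arc_length (gamma t) - 2 * PI * alpha t)) /\
  (forall t : R, J t ->
     alpha t = 1 / arc_length (gamma t) *
       arc_integral (gamma t) (fun u : R => 1 / curvature (gamma t) (N t) u) ->
     exists l : R,
       is_derive_on J (fun s : R => arc_length (gamma s)) t l /\ l <= 0).
Proof.
  destruct Hsmooth as (D & D0 & HD). pose proof PI_RGT_0 as Hpi.
  set (X := fun i j t u => fst (D i j t u)). set (Y := fun i j t u => snd (D i j t u)).
  assert (cX : forall i j, jointly_continuous_on J (X i j)).
  { intros i j t u Jt. apply (filterlim_comp _ _ _ _ (fun p : R * R => fst p) _ _ _ (proj2 (proj2 (HD i j t u Jt)))).
    unfold X. destruct (D i j t u). apply continuous_fst. }
  assert (cY : forall i j, jointly_continuous_on J (Y i j)).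
  { intros i j t u Jt. apply (filterlim_comp _ _ _ _ (fun p : R * R => snd p) _ _ _ (proj2 (proj2 (HD i j t u Jt)))).
    unfold Y. destruct (D i j t u). apply continuous_snd. }
  assert (Xu : forall i j t u, J t -> is_derive (X i j t) u (X i (S j) t u)).
  { intros i j t u Jt. apply (is_derive_fst (D i j t)), (HD i j t u Jt). }
  assert (Yu : forall i j t u, J t -> is_derive (Y i j t) u (Y i (S j) t u)).
  { intros i j t u Jt. apply (is_derive_snd (D i j t)), (HD i j t u Jt). }
  assert (Xt : forall i j t u, locally t J -> is_derive (fun s => X i j s u) t (X (S i) j t u)).
  { intros i j t u Jt. apply (is_derive_on_interior J); auto.
    apply (is_derive_on_fst J (fun s => D i j s u)), HD. now apply locally_singleton. }
  assert (Yt : forall i j t u, locally t J -> is_derive (fun s => Y i j s u) t (Y (S i) j t u)).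
  { intros i j t u Jt. apply (is_derive_on_interior J); auto.
    apply (is_derive_on_snd J (fun s => D i j s u)), HD. now apply locally_singleton. }
  assert (C2 : forall t, J t -> C2_curve (gamma t) (X 0%nat 1%nat t) (Y 0%nat 1%nat t)
    (X 0%nat 2%nat t) (Y 0%nat 2%nat t)).
  { intros t Jt. split; [|split; [|split; [|split; [|split]]]].
    - intros u. apply (is_derive_ext (X 0%nat 0%nat t)); [|now apply Xu].
      intros v. unfold X. now rewrite D0.
    - intros u. apply (is_derive_ext (Y 0%nat 0%nat t)); [|now apply Yu].
      intros v. unfold Y. now rewrite D0.
    - intros u. now apply Xu.
    - intros u. now apply Yu.
    - now apply (jointly_continuous_on_snd J).
    - now apply (jointly_continuous_on_snd J). }
  assert (Un : forall t, J t -> unit_normal (gamma t) (N t)).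
  { intros t Jt u. destruct (HN t Jt u) as (? & ? & _). auto. }
  assert (Hv : forall t, J t -> forall u, velocity (gamma t) u <> (0, 0)).
  { intros t Jt. apply (Hcurve t Jt). }
  set (n2 := fun t u => X 0%nat 1%nat t u * X 0%nat 1%nat t u + Y 0%nat 1%nat t u * Y 0%nat 1%nat t u).
  assert (Hn2 : forall t u, J t -> 0 < n2 t u /\ speed (gamma t) u = sqrt (n2 t u)).
  { intros t u Jt. split.
    - apply (speed_C2_pos _ _ _ _ _ u (C2 t Jt)). auto.
    - apply (speed_C2 _ _ _ _ _ _ (C2 t Jt)). }
  set (g := fun t u => sqrt (n2 t u)).
  (* The time derivative of the speed. The mixed partial [X 1 1] is at once the [t]-derivative of
     [X 0 1] and the [u]-derivative of [X 1 0]. *)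
  set (dg := fun t u => (X 0%nat 1%nat t u * X 1%nat 1%nat t u + Y 0%nat 1%nat t u * Y 1%nat 1%nat t u) * / g t u).
  assert (cg : jointly_continuous_on J g).
  { apply (jointly_continuous_on_comp J sqrt n2).
    - apply jointly_continuous_on_plus; apply jointly_continuous_on_mult; auto.
    - intros t u Jt. apply continuity_pt_sqrt. left. now apply Hn2. }
  assert (cdg : jointly_continuous_on J dg).
  { apply (jointly_continuous_on_mult J _ (fun t u => / g t u)).
    - apply jointly_continuous_on_plus; apply jointly_continuous_on_mult; auto.
    - apply (jointly_continuous_on_comp J Rinv g); auto.
      intros t u Jt. apply (continuity_pt_inv id); [apply continuity_pt_id|].
      destruct (Hn2 t u Jt) as [H _]. apply sqrt_lt_R0 in H. unfold id, g. lra. }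
  (* The length element evolves by [v_t = - (alpha - 1/k) k v = v - alpha k v]. *)
  assert (Hdg : forall t u, J t ->
    dg t u = 1 * speed (gamma t) u - alpha t * (curvature (gamma t) (N t) u * speed (gamma t) u)).
  { intros t u Jt. destruct (Hn2 t u Jt) as [Hpos Hs].
    (* Both sides are time derivatives of [gamma] relative to [J], so uniqueness identifies the
       smooth field [D 1 0] with the flow velocity. *)
    assert (HW : forall v, D 1%nat 0%nat t v =
      ((alpha t - 1 / curvature (gamma t) (N t) v) * fst (N t v),
       (alpha t - 1 / curvature (gamma t) (N t) v) * snd (N t v))).
    { intros v. apply (is_derive_on_unique J (fun s => gamma s v) t); auto.
      apply (is_derive_on_ext J (fun s => D 0%nat 0%nat s v)); auto. now apply HD. }
    pose proof (normal_variation_tangential_derivative (gamma t) (N t) (D 1%nat 0%nat t) _ _ _ _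
      (X 1%nat 1%nat t) (Y 1%nat 1%nat t) _ u (C2 t Jt) (Hv t Jt) (Un t Jt) HW
      (fun v => Xu _ _ _ _ Jt) (fun v => Yu _ _ _ _ Jt)) as E.
    specialize (Hconvex t u Jt).
    transitivity (X 1%nat 1%nat t u * fst (tangent (gamma t) u) + Y 1%nat 1%nat t u * snd (tangent (gamma t) u)).
    - unfold tangent. rewrite (velocity_C2 _ _ _ _ _ _ (C2 t Jt)). cbn [fst snd].
      rewrite Hs. unfold dg, g, Rdiv. ring.
    - rewrite E. field. lra. }
  assert (HL : forall t, J t ->
     is_derive_on (V := R_NormedModule) J (fun s : R => arc_length (gamma s)) t
       (arc_length (gamma t) - 2 * PI * alpha t)).
  { intros t Jt.
    assert (cs := speed_continuity _ _ _ _ _ (C2 t Jt) (Hv t Jt)).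
    assert (ck := curvature_continuity _ (N t) _ _ _ _ (C2 t Jt) (Hv t Jt) (Un t Jt)
      (fun u => Hconvex t u Jt)).
    apply (is_derive_on_ext J (fun s => RInt (g s) 0 (2 * PI))); auto.
    - intros s Js. apply RInt_ext. intros u _. rewrite Rmult_1_l. symmetry. now apply Hn2.
    - replace (arc_length (gamma t) - 2 * PI * alpha t) with (RInt (dg t) 0 (2 * PI)).
      + apply is_derive_on_RInt_param; auto; [lra|].
        intros r u Jr. apply (is_derive_euclidean_norm (fun s => X 0%nat 1%nat s u)
          (fun s => Y 0%nat 1%nat s u)); auto.
        apply Hn2. now apply locally_singleton.
      (* Writing [2 * PI] back as the total curvature makes every term an integral over the same
         curve. *)
      + replace (2 * PI * alpha t)
          with (alpha t * arc_integral (gamma t) (curvature (gamma t) (N t))).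
        2:{ rewrite (total_curvature_convex _ _ _ _ _ _ (C2 t Jt) (Hcurve t Jt) (Un t Jt)
              (fun u => Hconvex t u Jt)). ring. }
        apply is_RInt_unique.
        apply (is_RInt_ext (fun u => 1 * speed (gamma t) u -
          alpha t * (curvature (gamma t) (N t) u * speed (gamma t) u))).
        { intros u _. symmetry. now apply Hdg. }
        apply (is_RInt_minus (V := R_NormedModule) (fun u => 1 * speed (gamma t) u)).
        * now apply (is_RInt_arc_integral (gamma t) (fun _ => 1)), continuity_const.
        * apply (is_RInt_scal (V := R_NormedModule)). now apply is_RInt_arc_integral. }
  split; [exact HL|]. intros t Jt Ea.
  exists (arc_length (gamma t) - 2 * PI * alpha t). split; [now apply HL|].
  assert (Lpos : 0 < arc_length (gamma t)).
  { apply RInt_gt_0; [lra| |].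
    - intros u _. rewrite Rmult_1_l. destruct (Hn2 t u Jt) as [H ->]. now apply sqrt_lt_R0.
    - intros u _. apply continuity_pt_filterlim.
      apply (continuity_pt_mult (fun _ => 1) (speed (gamma t))).
      + apply continuity_const. now intros ? ?.
      + apply (speed_continuity _ _ _ _ _ (C2 t Jt) (Hv t Jt)). }
  pose proof (length_sqr_le_convex _ (N t) _ _ _ _ (C2 t Jt) (Hcurve t Jt) (Un t Jt)
    (fun u => Hconvex t u Jt)) as Hle.
  rewrite Ea. set (L := arc_length (gamma t)) in *. set (I := arc_integral _ _) in *.
  apply (Rmult_le_reg_l L); auto.
  (* After multiplication by [L > 0] the claim is [L^2 <= 2 * PI * I]. *)
  replace (L * (L - 2 * PI * (1 / L * I))) with (L * L - 2 * PI * I) by (field; lra). lra.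
Qed.
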